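(* Let $C\subset\mathbb{R}^n$ be a full-dimensional closed convex cone whose algebraic boundary is a smooth projective hypersurface in $\mathbb{P}^{n-1}$ defined by a homogeneous polynomial of degree $d$. If $n\ge4$, $d\ge3$ and $(n,d)\neq(4,4)$, then $C\cap\mathbb{Z}^n$ is not $(R,G)$-finitely generated.
   Context: The algebraic boundary of $C$ is the Zariski closure in $\mathbb{C}^n$ of the topological boundary of $C$; since $C$ is a cone, it is viewed as a projective hypersurface in $\mathbb{P}^{n-1}=\mathbb{P}(\mathbb{C}^n)$ defined by a single homogeneous polynomial, and it is called smooth if this polynomial defines a nonsingular hypersurface over $\mathbb{C}$. $\mathrm{GL}(n,\mathbb{Z})$ is the group of integer $n\times n$ matrices with determinant $\pm1$. For a convex cone $C\subseteq\mathbb{R}^n$ let $S_C:=C\cap\mathbb{Z}^n$. $S_C$ is called $(R,G)$-finitely generated if there exist a finite subset $R\subseteq S_C$ and a finitely generated subgroup $G\subseteq\mathrm{GL}(n,\mathbb{Z})$ acting linearly on $C$ (written $x\mapsto T\cdot x$) such that (1) $G\cdot C=C$ and $G\cdot S_C=S_C$, and (2) every $s\in S_C$ can be written as a finite sum $s=\sum_{i}\lambda_i\,T_i\cdot r_i$ with $r_i\in R$, $T_i\in G$, $\lambda_i\in\mathbb{Z}_{\ge0}$. ''Not $(R,G)$-finitely generated'' means no such pair exists. *)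

(* Defs.v *)
(* multinomials' mpoly is imported without its notations, which clash with
   those of MathComp-Analysis: [mpoly n K] is {mpoly K[n]}, [meval v p] is
   p.@[v], [ishomog1 d mdeg] is d.-homog and [mderiv i p] is the i-th partial
   derivative of p. *)
From HB Require Import structures.
From mathcomp Require Import all_boot all_order all_algebra.
From mathcomp Require Import complex.
From mathcomp Require Import boolp classical_sets functions cardinality reals.
From mathcomp Require Import topology normedtype.
From mathcomp Require Import -(notations) mpoly.

Set Implicit Arguments.
Unset Strict Implicit.
Unset Printing Implicit Defensive.

Import Order.TTheory GRing.Theory Num.Theory.
Import numFieldNormedType.Exports.

Local Open Scope classical_set_scope.
Local Open Scope ring_scope.

Section Cones.
Variables (R : realType) (n : nat).
Implicit Types C : set 'cV[R]_n.

Definition convex_cone C :=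
  C !=set0 /\
  forall (a b : R) (x y : 'cV[R]_n),
    0 <= a -> 0 <= b -> C x -> C y -> C (a *: x + b *: y).

(* The linear span of C is the whole space. *)
Definition full_dimensional C :=
  forall U : {vspace 'cV[R]_n}, (forall x, C x -> x \in U) -> U = fullv.

Definition boundary C : set 'cV[R]_n := closure C `\` interior C.

End Cones.

Section AlgebraicBoundary.

Definition peval (K : comNzRingType) (n : nat)
    (p : mpoly n K) (z : 'cV[K]_n) : K :=
  meval (fun i => z i ord0) p.

Definition zero_locus (K : comNzRingType) (n : nat) (p : mpoly n K) :
    set 'cV[K]_n :=
  [set z | peval p z = 0].

Definition zariski_closure (K : comNzRingType) (n : nat) (A : set 'cV[K]_n) :
    set 'cV[K]_n :=
  \bigcap_(p in [set p : mpoly n K | A `<=` zero_locus p]) zero_locus p.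

Definition algebraic_boundary (R : realType) (n : nat) (C : set 'cV[R]_n) :
    set 'cV[R[i]]_n :=
  zariski_closure (map_mx (real_complex R) @` boundary C).

Definition homogeneous (K : comNzRingType) (n d : nat) (f : mpoly n K) :=
  f \is ishomog1 d mdeg.

(* Jacobian criterion for {f = 0} in P^(n-1), on the affine cone. *)
Definition nonsingular (K : comNzRingType) (n : nat) (f : mpoly n K) :=
  forall z : 'cV[K]_n, z != 0 -> zero_locus f z ->
    exists i : 'I_n, peval (mderiv i f) z != 0.

(* The affine cone over the projective hypersurface {f = 0} is the Zariski
   closure in C^n; nonsingularity is that of f itself, i.e. scheme-theoretic,
   so it excludes powers of a defining polynomial. *)
Definition smooth_algebraic_boundary (R : realType) (n d : nat)
    (C : set 'cV[R]_n) :=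
  exists f : mpoly n R[i],
    [/\ homogeneous d f,
        algebraic_boundary C = zero_locus f
      & nonsingular f].

End AlgebraicBoundary.

Section FiniteGeneration.
Variables (R : realType) (n : nat).

Definition GLnZ : set 'M[int]_n := [set T | \det T = 1 \/ \det T = -1].

Definition is_subgroup (G : set 'M[int]_n) :=
  [/\ G `<=` GLnZ,
      G 1%:M,
      forall S T, G S -> G T -> G (S *m T)
    & forall T, G T -> G (invmx T)].

Definition fg_subgroup (G : set 'M[int]_n) :=
  is_subgroup G /\
  exists B : set 'M[int]_n, finite_set B /\ G = smallest is_subgroup B.

Definition act (T : 'M[int]_n) (x : 'cV[R]_n) : 'cV[R]_n :=
  map_mx intr T *m x.

Definition orbit_set (G : set 'M[int]_n) (A : set 'cV[R]_n) : set 'cV[R]_n :=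
  [set act T x | T in G & x in A].

Definition lattice_points (C : set 'cV[R]_n) : set 'cV[R]_n :=
  C `&` range (fun z : 'cV[int]_n => map_mx intr z).

Definition RG_generated_by
    (C Rt : set 'cV[R]_n) (G : set 'M[int]_n) :=
  [/\ finite_set Rt,
      Rt `<=` lattice_points C,
      fg_subgroup G,
      orbit_set G C = C /\
        orbit_set G (lattice_points C) = lattice_points C
    & forall s, lattice_points C s ->
        exists (k : nat) (r : 'I_k -> 'cV[R]_n) (T : 'I_k -> 'M[int]_n)
               (lam : 'I_k -> nat),
          (forall i, Rt (r i) /\ G (T i)) /\
          s = \sum_(i < k) act (T i) (r i) *+ lam i].

Definition RG_finitely_generated (C : set 'cV[R]_n) :=
  exists (Rt : set 'cV[R]_n) (G : set 'M[int]_n), RG_generated_by C Rt G.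

End FiniteGeneration.

(* Main.v *)
Require Import Defs.
From HB Require Import structures.
From mathcomp Require Import all_boot all_order all_algebra.
From mathcomp Require Import complex.
From mathcomp Require Import boolp classical_sets functions cardinality reals.
From mathcomp Require Import topology normedtype.
From mathcomp Require Import -(notations) mpoly.
From mathcomp Require Import zify ring lra.
Import Order.TTheory GRing.Theory Num.Theory.
Import numFieldNormedType.Exports.
Local Open Scope classical_set_scope.
Local Open Scope ring_scope.

Set Implicit Arguments.
Unset Strict Implicit.
Unset Printing Implicit Defensive.

(** Let [f] be the smooth form of degree [d >= 3] that cuts out the algebraic
boundary, so that [grad f] vanishes only at the origin.  Every [T] in [G] maps
the zero set of [f] to itself, and a pigeonhole argument on root multisets along
lines gives a power [A] of [T] with [f (A x) = c f (x)].  Differentiating,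
[grad f (A x) A = c grad f (x)].  At an eigenvector of eigenvalue [a] this makes
[c / a^(d-1)] an eigenvalue too; since [d - 1 >= 2] and the spectrum is finite
with product [1] or [-1], all eigenvalues are roots of unity, so a power [S] of
[A] is unipotent.  If [S] were not [1], comparing growth in [k] on both sides of
[grad f (S^k x) = grad f (x) S^-k] would give a contradiction.  Hence [G] is
torsion, and by Minkowski's congruence argument modulo 3 it is finite.  The
lattice points of [C] then form a finitely generated monoid, [C] is polyhedral,
its boundary lies in finitely many hyperplanes, and [f] is a product of linear
forms, which is singular. *)

(** * Substituting univariate polynomials into a form *)

Section Substitution.
Variables (K : idomainType) (n : nat).
Implicit Types (f : mpoly n K) (P : 'I_n -> {poly K}).

Definition substp P f : {poly K} := mmap (@polyC K) P f.

Lemma horner_substp P f t :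
  (substp P f).[t] = meval (fun i => (P i).[t]) f.
Proof.
rewrite /substp /mmap mevalE horner_sum; apply: eq_bigr => m _.
rewrite hornerM hornerC /mmap1 horner_prod; congr (_ * _).
by apply: eq_bigr => i _; rewrite horner_exp.
Qed.

(** The chain rule holds for constants and variables and is stable under products, hence holds for
    monomials; linearity gives the rest. *)
Lemma deriv_substp P f :
  (substp P f)^`() = \sum_i substp P (mderiv i f) * (P i)^`().
Proof.
pose chain g :=
  (substp P g)^`() = \sum_i substp P (mderiv i g) * (P i)^`().
have chainM g h : chain g -> chain h -> chain (g * h).
  rewrite /chain /substp => cg ch; rewrite rmorphM /= derivM cg ch.
  rewrite mulr_suml mulr_sumr -big_split /=; apply: eq_bigr => i _.
  by rewrite mderivM rmorphD !rmorphM /=; ring.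
have chain1 : chain 1.
  rewrite /chain /substp rmorph1 derivC big1 // => i _.
  by rewrite -mpolyC1 mderivC rmorph0 mul0r.
have chainX (i : 'I_n) : chain (mpolyX K (mnm1 i)).
  have mBB : mnm_sub (mnm1 i) (mnm1 i) = mnm0.
    by apply/mnmP => j; rewrite mnmBE mnm0E subnn.
  rewrite /chain /substp mmapX mmap1U (bigD1 i) //= big1 => [|j ji].
    by rewrite mderivX mnm1E eqxx scale1r mBB mmapX mmap11 mul1r addr0.
  by rewrite mderivX mnm1E eq_sym (negPf ji) scale0r rmorph0 mul0r.
have chainXm (m : multinom n) : chain (mpolyX K m).
  rewrite mpolyXE_id; elim/big_ind: _ => // i _.
  by elim: (m i) => [|k IHk]; rewrite ?expr0 // exprS; apply: chainM.
rewrite -/(chain f); elim/mpolyind: f => [|c m g _ _ IH].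
  rewrite /chain /substp rmorph0 deriv0 big1 // => i _.
  by rewrite mderiv0 rmorph0 mul0r.
move: IH (chainXm m); rewrite /chain /substp rmorphD derivD /= => -> cX.
rewrite mmapZ mul_polyC derivZ cX scaler_sumr -big_split; apply: eq_bigr => i _.
by rewrite /= mderivD mderivZ rmorphD /= mmapZ mulrDl -!mul_polyC mulrA.
Qed.

(** The value [c] may be zero: [a] only bounds the degree, so the notion is multiplicative without
    side conditions. *)
Definition has_top (a : nat) (p : {poly K}) (c : K) :=
  (size p <= a.+1)%N /\ p`_a = c.

Lemma has_topM a b p q c e :
  has_top a p c -> has_top b q e -> has_top (a + b) (p * q) (c * e).
Proof.
move=> [sp <-] [sq <-]; split.
  apply: leq_trans (size_polyMleq _ _) _; lia.
have ha : (a < (a + b).+1)%N by lia.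
rewrite coefM (bigD1 (Ordinal ha)) //= addKn big1 ?addr0 // => i.
rewrite -val_eqE /= => ia; case: (ltnP i a) => ia'.
  rewrite [X in _ * X]nth_default ?mulr0 //; apply: leq_trans sq _.
  have := ltn_ord i; lia.
rewrite [X in X * _]nth_default ?mul0r //; apply: leq_trans sp _; lia.
Qed.

Lemma has_top_prod (I : Type) (r : seq I) (a : I -> nat) (p : I -> {poly K})
    (c : I -> K) :
  (forall i, has_top (a i) (p i) (c i)) ->
  has_top (\sum_(i <- r) a i)%N (\prod_(i <- r) p i) (\prod_(i <- r) c i).
Proof.
move=> h; elim: r => [|i r IHr].
  by rewrite !big_nil; split; rewrite ?size_polyC ?coefC //; case: (_ == _).
by rewrite !big_cons; apply: has_topM.
Qed.

Lemma has_topX a p c k : has_top a p c -> has_top (a * k) (p ^+ k) (c ^+ k).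
Proof.
move=> h; elim: k => [|k IHk].
  by rewrite muln0 !expr0; split; rewrite ?size_polyC ?coefC //; case: (_ == _).
by rewrite mulnS !exprS; apply: has_topM.
Qed.

(** Each monomial of degree [d] in polynomials of degree at most [m] has degree at most [m * d], and
    its coefficient there is the same monomial in the top coefficients [z]. *)
Lemma has_top_substp (m d : nat) P (z : 'I_n -> K) f :
  homogeneous d f -> (forall i, has_top m (P i) (z i)) ->
  has_top (m * d) (substp P f) (meval z f).
Proof.
move=> /dhomogP hf hP; rewrite /substp /mmap mevalE.
have hm mm : mm \in msupp f ->
    has_top (m * d) ((mcoeff mm f)%:P * mmap1 P mm)
      (mcoeff mm f * \prod_i z i ^+ mm i).
  move=> mf; rewrite -[(m * d)%N]add0n; apply: has_topM.
    by split; rewrite ?coefC // size_polyC; case: (_ == _).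
  have -> : (m * d = \sum_(i < n) m * mm i)%N.
    by rewrite -big_distrr -(hf _ mf) /= mdegE.
  by apply: has_top_prod => i; apply: has_topX.
split; last by rewrite coef_sum; apply: eq_big_seq => mm /hm[].
rewrite big_seq; elim/big_ind: _ => [|p q hp hq|mm /hm[]//].
  by rewrite size_poly0.
by apply: leq_trans (size_polyD _ _) _; rewrite geq_max hp hq.
Qed.

Lemma homogeneous_mderiv d f i :
  homogeneous d f -> homogeneous d.-1 (mderiv i f).
Proof.
move=> /dhomogP hf; apply/dhomogP => m.
rewrite mcoeff_msupp mcoeff_mderiv => h.
have : mnm_add m (mnm1 i) \in msupp f.
  by rewrite mcoeff_msupp; apply: contraNneq h => ->; rewrite mul0rn.
by move=> /hf; rewrite /= mdegD mdeg1 addn1 => <-.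
Qed.

Lemma meval_homogeneous d f (a : K) (z : 'I_n -> K) :
  homogeneous d f -> meval (fun i => a * z i) f = a ^+ d * meval z f.
Proof.
move=> /dhomogP hf; rewrite !mevalE mulr_sumr; apply: eq_big_seq => m mf.
rewrite mulrCA; congr (_ * _); under eq_bigr do rewrite exprMn.
rewrite big_split /=; congr (_ * _).
by rewrite -(hf _ mf) /= mdegE expr_sum.
Qed.

End Substitution.

(** * Restriction to lines and gradients *)

Section Lines.
Variables (K : numClosedFieldType) (n : nat).
Implicit Types (f : mpoly n K) (x y z v : 'cV[K]_n) (A : 'M[K]_n).

(** In characteristic zero the naturals are infinitely many points. This turns identities between
    [k]-th iterates into identities of polynomials in [k]. *)
Lemma poly_eq_nat (p q : {poly K}) :
  (forall k : nat, p.[k%:R] = q.[k%:R]) -> p = q.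
Proof.
move=> pq; apply/eqP; rewrite -subr_eq0.
apply/eqP/(@roots_geq_poly_eq0 _ _ [seq k%:R | k <- iota 0 (size (p - q))]).
- by apply/allP => _ /mapP[k _ ->]; rewrite rootE hornerD hornerN pq subrr.
- by rewrite map_inj_uniq ?iota_uniq //; apply: (mulrIn (oner_neq0 _)).
- by rewrite size_map size_iota.
Qed.

Lemma poly_eq_fun (p q : {poly K}) : (forall t, p.[t] = q.[t]) -> p = q.
Proof. by move=> pq; apply: poly_eq_nat. Qed.

Lemma pevalZ d f a x :
  homogeneous d f -> peval f (a *: x) = a ^+ d * peval f x.
Proof.
move=> hf; rewrite -(meval_homogeneous a (fun i => x i ord0) hf).
by apply: meval_eq => i; rewrite mxE.
Qed.

Definition line f x v : {poly K} :=
  substp (fun i => (x i ord0)%:P + v i ord0 *: 'X) f.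

Lemma horner_line f x v t : (line f x v).[t] = peval f (x + t *: v).
Proof.
rewrite horner_substp; apply: meval_eq => i.
by rewrite !mxE !hornerE mulrC.
Qed.

Lemma has_top_line d f x v :
  homogeneous d f -> has_top d (line f x v) (peval f v).
Proof.
move=> hf; rewrite -[d]mul1n; apply: has_top_substp => // i; split.
  rewrite (leq_trans (size_polyD _ _)) // geq_max size_polyC.
  rewrite (leq_trans (size_scale_leq _ _)) ?size_polyX //.
  by rewrite andbT; case: (_ == _).
by rewrite coefD coefC coefZ coefX /= add0r mulr1.
Qed.

Definition grad f x : 'rV[K]_n := \row_i peval (mderiv i f) x.

Lemma deriv_line f x v : (line f x v)^`().[0] = (grad f x *m v) ord0 ord0.
Proof.
rewrite deriv_substp horner_sum mxE; apply: eq_bigr => i _.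
rewrite hornerM mxE horner_substp; congr (_ * _).
  by apply: meval_eq => j; rewrite !hornerE.
by rewrite derivD derivC derivZ derivX !hornerE.
Qed.

(** The partial derivatives are homogeneous of degree [d.-1]. *)
Lemma gradZ d f a x :
  homogeneous d f -> grad f (a *: x) = a ^+ d.-1 *: grad f x.
Proof.
move=> hf; apply/rowP => i; rewrite !mxE.
exact: (pevalZ _ _ (homogeneous_mderiv i hf)).
Qed.

Lemma row_ext (w w' : 'rV[K]_n) :
  (forall v, (w *m v) ord0 ord0 = (w' *m v) ord0 ord0) -> w = w'.
Proof.
move=> ww; apply/rowP => j; have := ww (delta_mx j ord0).
by rewrite -!colE !mxE.
Qed.

(** Differentiate [f (A y) = c f (y)] at [x] along every direction [v]. Gradients are rows, so [A]
    acts on them from the right. *)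
Lemma grad_chain f A c x :
  (forall y, peval f (A *m y) = c * peval f y) ->
  grad f (A *m x) *m A = c *: grad f x.
Proof.
move=> fA; apply: row_ext => v.
rewrite -mulmxA -deriv_line -scalemxAl mxE -deriv_line.
have -> : line f (A *m x) (A *m v) = c *: line f x v.
  apply: poly_eq_fun => t; rewrite hornerZ !horner_line -fA.
  by rewrite mulmxDr scalemxAr.
by rewrite derivZ hornerZ.
Qed.

(** On the line [x + t x = (1 + t) x] the form equals [(1 + t)^d f(x)]; differentiate at [t = 0]. *)
Lemma euler d f x :
  homogeneous d f -> (grad f x *m x) ord0 ord0 = d%:R * peval f x.
Proof.
move=> hf; rewrite -deriv_line.
have -> : line f x x = (1 + 'X) ^+ d * (peval f x)%:P.
  apply: poly_eq_fun => t; rewrite horner_line !hornerE.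
  by rewrite -[in LHS](scale1r x) scalerA mulr1 -scalerDl (pevalZ _ _ hf).
rewrite derivM derivC mulr0 addr0 deriv_exp derivD derivC derivX.
rewrite add0r ?mulr1 ?mul1r.
rewrite hornerM hornerC hornerMn horner_exp hornerD hornerX hornerC.
by rewrite addr0 expr1n.
Qed.

(** On the zero locus this is nonsingularity; off it, Euler's identity gives
    [grad f x *m x = d f(x)], which is nonzero in characteristic zero. *)
Lemma grad_neq0 d f x :
  homogeneous d f -> (0 < d)%N -> nonsingular f -> x != 0 -> grad f x != 0.
Proof.
move=> hf d0 sf x0; have [fx|fx] := eqVneq (peval f x) 0.
  have [ i ] := sf x x0 fx; apply: contraNneq => /rowP/(_ i).
  by rewrite !mxE => ->.
apply: contra_neq fx => g0; have := euler x hf.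
rewrite g0 mul0mx mxE => /esym/eqP.
by rewrite mulf_eq0 pnatr_eq0 eqn0Ngt d0 => /eqP.
Qed.

(** The coefficient of [t^d] in [f (x + t v)] is [f(v)], so the degree is exactly [d] and there are
    [d] roots with multiplicity. *)
Lemma line_split d f x v :
  homogeneous d f -> peval f v != 0 ->
  exists r : d.-tuple K, forall t,
    peval f (x + t *: v) = peval f v * \prod_(j < d) (t - tnth r j).
Proof.
move=> hf fv; have [sp ed] := has_top_line x v hf.
have sz : size (line f x v) = d.+1.
  apply/eqP; rewrite eqn_leq sp /= ltnNge.
  by apply: contra fv => /leq_sizeP/(_ d (leqnn _)); rewrite ed => ->.
have [r er] := closed_field_poly_normal (line f x v).
have lc : lead_coef (line f x v) = peval f v by rewrite lead_coefE sz.
have sr : size r = d.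
  by move: sz; rewrite er lc size_scale // size_prod_XsubC => -[].
subst d; exists (in_tuple r) => t; rewrite -horner_line er lc hornerZ.
rewrite horner_prod big_tnth; congr (_ * _).
by apply: eq_bigr => j _; rewrite !hornerE.
Qed.

Lemma line_split_root d f x v (r : d.-tuple K) j :
  (forall t, peval f (x + t *: v) =
    peval f v * \prod_(j < d) (t - tnth r j)) ->
  peval f (x + tnth r j *: v) = 0.
Proof. by move=> ->; rewrite (bigD1 j) //= subrr mul0r mulr0. Qed.

(* Used in place of polynomial functions: univariate polynomials on lines are
   enough to see that a product of nonzero functions is nonzero. *)
Definition line_poly (F : 'cV[K]_n -> K) :=
  forall a b, exists p : {poly K}, forall t, F (a + t *: b) = p.[t].

Lemma line_poly_peval f : line_poly (peval f).
Proof. by move=> a b; exists (line f a b) => t; rewrite horner_line. Qed.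

Lemma line_poly_comp F A : line_poly F -> line_poly (fun y => F (A *m y)).
Proof.
move=> hF a b; have [p hp] := hF (A *m a) (A *m b); exists p => t.
by rewrite mulmxDr -scalemxAr.
Qed.

Lemma line_poly_linear (w : 'rV[K]_n) :
  line_poly (fun y => (w *m y) ord0 ord0).
Proof.
move=> a b.
exists (((w *m a) ord0 ord0)%:P + (w *m b) ord0 ord0 *: 'X) => t.
by rewrite !hornerE mulmxDr -scalemxAr !mxE mulrC.
Qed.

Lemma line_polyC c : line_poly (fun=> c).
Proof. by move=> a b; exists c%:P => t; rewrite hornerC. Qed.

Lemma line_polyM F G :
  line_poly F -> line_poly G -> line_poly (fun y => F y * G y).
Proof.
move=> hF hG a b; have [[p hp] [q hq]] := (hF a b, hG a b).
by exists (p * q) => t; rewrite hornerM hp hq.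
Qed.

Lemma line_polyB F G :
  line_poly F -> line_poly G -> line_poly (fun y => F y - G y).
Proof.
move=> hF hG a b; have [[p hp] [q hq]] := (hF a b, hG a b).
by exists (p - q) => t; rewrite hornerD hornerN hp hq.
Qed.

Lemma line_poly_prod (I : Type) (s : seq I) (F : I -> 'cV[K]_n -> K) :
  (forall i, line_poly (F i)) -> line_poly (fun y => \prod_(i <- s) F i y).
Proof.
move=> hF; elim: s => [|i s IHs] a b.
  by exists 1 => t; rewrite big_nil hornerC.
have [[p hp] [q hq]] := (hF i a b, IHs a b).
by exists (p * q) => t; rewrite hornerM big_cons hp hq.
Qed.

(** On the line through a nonzero of [F] and a nonzero of [G], both restrict to nonzero polynomials,
    whose product is nonzero. *)
Lemma line_poly_mul_neq0 F G :
  line_poly F -> line_poly G -> (exists x, F x != 0) -> (exists x, G x != 0) ->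
  exists x, F x * G x != 0.
Proof.
move=> hF hG [x Fx] [y Gy].
have [[p hp] [q hq]] := (hF x (y - x), hG x (y - x)).
have p0 : p != 0.
  apply: contraNneq Fx => p0; have := hp 0.
  by rewrite scale0r addr0 p0 horner0 => ->.
have q0 : q != 0.
  apply: contraNneq Gy => q0; have := hq 1.
  by rewrite scale1r addrC subrK q0 horner0 => ->.
have : p * q != 0 by rewrite mulf_neq0.
apply: contraPP => /forallNP h; apply/negP; rewrite negbK; apply/eqP.
apply: poly_eq_fun => t; rewrite horner0 hornerM -hp -hq.
by have /negP := h (x + t *: (y - x)); rewrite negbK => /eqP.
Qed.

Lemma common_nonzero (I : finType) (F : I -> 'cV[K]_n -> K) :
  (forall i, line_poly (F i)) -> (forall i, exists x, F i x != 0) ->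
  exists x, forall i, F i x != 0.
Proof.
move=> hF nF.
suff /(_ (index_enum I)) [x /prodf_neq0 hx] :
    forall s : seq I, exists x, \prod_(i <- s) F i x != 0.
  by exists x => i; apply: hx.
elim=> [|i s IHs]; first by exists 0; rewrite big_nil oner_neq0.
have [||x hx] := line_poly_mul_neq0 (hF i) (line_poly_prod s hF) => //.
by exists x; rewrite big_cons.
Qed.

(** Affine space is not a finite union of proper closed subsets. This makes a choice of index that
    depends on the point uniform. *)
Lemma vanishing_factor (I : finType) (F : I -> 'cV[K]_n -> K) :
  (forall i, line_poly (F i)) -> (forall x, exists i, F i x = 0) ->
  exists i, forall x, F i x = 0.
Proof.
move=> hF zF; apply: contrapT => /forallNP nz.
have [ i|x hx] := common_nonzero hF.
  by have /existsNP[x /eqP Fx] := nz i; exists x.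
by have [i /eqP] := zF x; rewrite (negPf (hx i)).
Qed.

(** If [f] vanished everywhere, so would its derivatives along lines, and the vector of ones would
    be a singular point. *)
Lemma nonsingular_neq0 f :
  (0 < n)%N -> nonsingular f -> exists v, peval f v != 0.
Proof.
move=> n0 sf; apply: contrapT => /forallNP f0.
have {}f0 v : peval f v = 0 by have /negP := f0 v; rewrite negbK => /eqP.
have [|i ] := sf (const_mx 1) _ (f0 _).
  apply/eqP => /colP/(_ (Ordinal n0)); rewrite !mxE.
  by apply/eqP; rewrite oner_neq0.
suff -> : peval (mderiv i f) (const_mx 1) = 0 by rewrite eqxx.
have := deriv_line f (const_mx 1) (delta_mx i ord0).
rewrite -colE !mxE => <-.
have -> : line f (const_mx 1) (delta_mx i ord0) = 0.
  by apply: poly_eq_fun => t; rewrite horner_line f0 horner0.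
by rewrite deriv0 horner0.
Qed.

End Lines.

(** * Linear automorphisms of a smooth form *)

Lemma pigeonhole (T : eqType) (s : seq T) (g : nat -> T) :
  (forall k, g k \in s) -> exists k l, (k < l)%N /\ g k = g l.
Proof.
move=> gs; have : ~~ uniq (mkseq g (size s).+1).
  apply/negP => u; have /(uniq_leq_size u) : {subset mkseq g (size s).+1 <= s}.
    by move=> _ /mapP[k _ ->].
  by rewrite size_mkseq ltnn.
move=> /(uniqPn (g 0%N)) [k [l [kl]]]; rewrite size_mkseq => lM.
by rewrite !nth_mkseq // ?(ltn_trans kl) // => e; exists k, l.
Qed.

(** The number of terms does not depend on [k], so the powers of a unipotent element are polynomial
    in [k]. *)
Lemma exprD1_nilp (A : pzRingType) (N : A) m k :
  N ^+ m.+1 = 0 -> (1 + N) ^+ k = \sum_(j < m.+1) N ^+ j *+ 'C(k, j).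
Proof.
move=> N0; elim: k => [|k IHk].
  by rewrite big_ord_recl big1 ?addr0 // => j _; rewrite bin0n mulr0n.
rewrite exprS IHk mulrDl mul1r mulr_sumr.
under [X in _ + X]eq_bigr do rewrite mulrnAr -exprS.
rewrite [X in _ + X]big_ord_recr /= N0 mul0rn addr0 big_ord_recl.
rewrite [RHS]big_ord_recl /= !bin0 -addrA -big_split /=; congr (_ + _).
by apply: eq_bigr => j _; rewrite binS mulrnDr.
Qed.

(** Eigenvectors in the sense of [eigenvalue] are rows; transposition gives access to column
    eigenvectors. *)
Lemma char_poly_tr (F : comNzRingType) n (A : 'M[F]_n) :
  char_poly A^T = char_poly A.
Proof.
rewrite /char_poly -det_tr; congr (\det _).
by apply/matrixP => i j; rewrite !mxE eq_sym.
Qed.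

(** * Binomial coefficients as polynomials in their upper argument *)

Section BinomialPoly.
Variable K : numFieldType.

Definition binp (j : nat) : {poly K} :=
  (j`!%:R)^-1 *: \prod_(i < j) ('X - (i%:R)%:P).

Lemma horner_binp j k : (binp j).[k%:R] = ('C(k, j))%:R.
Proof.
have hf : (\prod_(i < j) ('X - (i%:R)%:P : {poly K})).[k%:R] = (k ^_ j)%:R.
  elim: j => [|j IHj]; first by rewrite big_ord0 hornerC.
  rewrite big_ord_recr /= hornerM IHj ffactnSr natrM !hornerE.
  have [jk|kj] := leqP j k; first by rewrite natrB.
  by rewrite ffact_small // !mul0r.
rewrite hornerZ hf -bin_ffact natrM mulrC mulfK //.
by rewrite pnatr_eq0 -lt0n fact_gt0.
Qed.

Lemma has_top_binp j : has_top j (binp j) (j`!%:R)^-1.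
Proof.
have [s c] : has_top j (\prod_(i < j) ('X - (i%:R)%:P : {poly K})) 1.
  have h (i : 'I_j) : has_top 1 ('X - (i%:R)%:P : {poly K}) 1.
    by split; rewrite ?size_XsubC // coefB coefX coefC subr0.
  have := has_top_prod (index_enum 'I_j) h.
  by rewrite big_const_ord iter_addn_0 mul1n big1_eq.
split; first exact: leq_trans (size_scale_leq _ _) s.
by rewrite coefZ c mulr1.
Qed.

Lemma has_top_binp_sum m (a : nat -> K) :
  has_top m (\sum_(j < m.+1) a j *: binp j) (a m / m`!%:R).
Proof.
split.
  elim/big_ind: _ => [|p q hp hq|j _]; first by rewrite size_poly0.
    by apply: leq_trans (size_polyD _ _) _; rewrite geq_max hp hq.
  apply: leq_trans (size_scale_leq _ _) _.
  have [s _] := has_top_binp j; apply: leq_trans s _.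
  exact: (ltn_ord j).
rewrite coef_sum big_ord_recr /= big1 => [|j _].
  by have [_ c] := has_top_binp m; rewrite add0r coefZ c.
have [s _] := has_top_binp j.
by rewrite coefZ [X in _ * X]nth_default ?mulr0 // (leq_trans s).
Qed.

End BinomialPoly.

Section LinearAutomorphisms.
Variables (K : numClosedFieldType) (n' d : nat) (f : mpoly n'.+1 K).
Let n := n'.+1.
Hypotheses (hf : homogeneous d f) (d_ge3 : (3 <= d)%N) (sf : nonsingular f).
Implicit Types (A S : 'M[K]_n).

(* For fixed [y] and [v] the polynomials [f (A^k (y + t v))] in [t] have, up to
   scaling, degree [d] and roots among those of [f (y + t v)], so two of them
   are proportional. *)
Lemma semi_invariant_power A :
  A \is a GRing.unit ->
  (forall z, peval f (A *m z) = 0 -> peval f z = 0) ->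
  exists m c, (0 < m)%N /\
    forall x, peval f (A ^+ m *m x) = c * peval f x.
Proof.
move=> uA fA; have [v fv] := nonsingular_neq0 (ltn0Sn n') sf.
have fAk k z : peval f (A ^+ k *m z) = 0 -> peval f z = 0.
  elim: k z => [|k IHk] z; first by rewrite expr0 mul1mx.
  by rewrite exprS -mulmxA => /fA /IHk.
have nv k : peval f (A ^+ k *m v) != 0.
  by apply: contra_neq fv => /fAk.
(* [M] exceeds by one the number of ways to pick [d] roots, with repetition, from a list of [d]. *)
pose T := {ffun 'I_d -> 'I_d}; pose M := #|T|.+1.
pose I := {p : 'I_M * 'I_M | (p.1 < p.2)%N}.
(* For [p = (k, l)], vanishing at [y] says that [f (A^k y) / f (A^k v)] and [f (A^l y) / f (A^l v)]
   agree; without denominators this is polynomial on lines. *)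
pose F (p : I) y :=
  peval f (A ^+ (val p).1 *m y) * peval f (A ^+ (val p).2 *m v)
  - peval f (A ^+ (val p).2 *m y) * peval f (A ^+ (val p).1 *m v).
have lF p : line_poly (F p).
  by apply: line_polyB; apply: line_polyM; try exact: line_polyC;
    apply: line_poly_comp; apply: line_poly_peval.
have zF y : exists p, F p y = 0.
  have [r0 h0] := line_split y hf fv.
  (* The map [tau k] records which roots of [f (y + t v)] occur as roots of [f (A^k (y + t v))]; the
     formula is the factorization at [t = 0]. *)
  have /choice[tau htau] k : exists tau : T, peval f (A ^+ k *m y) =
      peval f (A ^+ k *m v) * \prod_(j < d) - tnth r0 (tau j).
    have [r hr] := line_split (A ^+ k *m y) hf (nv k).
    have /choice[tau ht] j : exists i, tnth r j = tnth r0 i.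
      have := line_split_root j hr; rewrite scalemxAr -mulmxDr => /fAk.
      rewrite h0 => /eqP; rewrite mulf_eq0 (negPf fv) /= => /prodf_eq0[i _].
      by rewrite subr_eq0 => /eqP; exists i.
    exists [ffun j => tau j]; have := hr 0; rewrite scale0r addr0 => ->.
    by congr (_ * _); apply: eq_bigr => j _; rewrite sub0r ffunE ht.
  have : ~~ injectiveb (fun k : 'I_M => tau k).
    by apply/injectiveP => /leq_card; rewrite card_ord ltnn.
  move=> /injectivePn [k [l kl e]].
  wlog {kl} kl : k l e / (k < l)%N.
    move: kl; rewrite -val_eqE neq_ltn => /orP[] h H; first exact: (H k l).
    by apply: (H l k).
  by exists (exist _ (k, l) kl : I); rewrite /F /= !htau e; ring.
(* From here on the pair [k < l] no longer depends on the point [y]. *)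
have [[[k l] kl] /= h] := vanishing_factor lF zF.
exists (l - k)%N, (peval f (A ^+ l *m v) / peval f (A ^+ k *m v)).
split=> [|x]; first by rewrite subn_gt0.
have uAk : A ^+ k \is a GRing.unit by rewrite unitrX.
have /eqP := h ((A ^+ k)^-1 *m x); rewrite /F /= subr_eq0 => /eqP.
rewrite !mulmxA; have -> : A ^+ k *m (A ^+ k)^-1 = 1%:M by apply: mulrV.
have -> : A ^+ l *m (A ^+ k)^-1 = A ^+ (l - k).
  rewrite -[in LHS](subnK (ltnW kl)) exprD -mulmxE -mulmxA.
  by rewrite [X in _ *m X]mulrV ?mulmx1.
rewrite mul1mx => e; apply: (mulIf (nv k)); rewrite -e.
by rewrite [RHS]mulrAC divfK // mulrC.
Qed.

(** If [z] is a column eigenvector for [a], then [grad_chain] and homogeneity make [grad f z] a row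
    eigenvector for [c / a ^+ d.-1]; it is nonzero by smoothness. *)
Lemma eigenvalue_semi_invariant A c a :
  A \is a GRing.unit -> (forall x, peval f (A *m x) = c * peval f x) ->
  root (char_poly A) a ->
  a != 0 /\ root (char_poly A) (c / a ^+ d.-1).
Proof.
move=> uA fA; rewrite -char_poly_tr -!eigenvalue_root_char.
move=> /eigenvalueP[u ua u0]; set z := u^T.
have z0 : z != 0 by rewrite trmx_eq0.
have Az : A *m z = a *: z by rewrite -[A]trmxK -trmx_mul ua linearZ.
have a0 : a != 0.
  apply: contra_neq z0 => a0; move: Az; rewrite a0 scale0r => Az.
  by rewrite -[z]mul1mx -[1%:M](mulVr uA) -mulmxE -mulmxA Az mulmx0.
split=> //; rewrite eigenvalue_root_char char_poly_tr -eigenvalue_root_char.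
apply/eigenvalueP; exists (grad f z); last first.
  by apply: (grad_neq0 hf) => //; lia.
have := grad_chain z fA; rewrite Az (gradZ _ _ hf) -scalemxAl => e.
rewrite mulrC -scalerA -e scalerA mulVf ?scale1r //.
by rewrite expf_neq0.
Qed.

Lemma semi_invariant_neq0 A c :
  A \is a GRing.unit -> (forall x, peval f (A *m x) = c * peval f x) -> c != 0.
Proof.
move=> uA fA; have [v fv] := nonsingular_neq0 (ltn0Sn n') sf.
apply: contra_neq fv => c0; have := fA (A^-1 *m v).
rewrite mulmxA; have -> : A *m A^-1 = 1%:M by apply: mulrV.
by rewrite mul1mx c0 mul0r.
Qed.

(** The map [a |-> c / a ^+ d.-1] fixes [g]. In terms of [u = a / g] it inverts [u ^+ d.-1], so
    applying it twice raises [u] to the power [q = (d - 1)^2 >= 4]. In a finite set two iterates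
    agree, and their exponents [q ^ k] differ. *)
Lemma finite_orbit_root_of_unity (s : seq K) (g c : K) :
  g ^+ d = c -> c != 0 ->
  (forall a, a \in s -> a != 0 /\ c / a ^+ d.-1 \in s) ->
  exists2 N, (0 < N)%N & forall a, a \in s -> (a / g) ^+ N = 1.
Proof.
move=> gd c0 hs; have g0 : g != 0.
  by apply: contraNneq c0 => g0; rewrite -gd g0 expr0n; case: (d) d_ge3.
have one a : a \in s -> exists2 N, (0 < N)%N & (a / g) ^+ N = 1.
  move=> sa; pose q := (d.-1 * d.-1)%N; set u := a / g.
  have u0 : u != 0 by have [a0 _] := hs a sa; rewrite mulf_neq0 ?invr_neq0.
  have step w : g * w \in s -> g * w ^+ q \in s.
    move=> /hs[+ /hs[_]]; rewrite mulf_eq0 negb_or => /andP[_ w0].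
    rewrite (_ : c / _ = g * w ^+ q) //.
    have gd' : c = g ^+ d.-1 * g by rewrite -exprSr prednK //; lia.
    have gq : g ^+ d.-1 != 0 by rewrite expf_neq0.
    have wq : w ^+ d.-1 != 0 by rewrite expf_neq0.
    have -> : c / (g * w) ^+ d.-1 = g / w ^+ d.-1.
      by rewrite gd' exprMn; field; rewrite wq gq.
    rewrite expr_div_n -exprM gd' -/q; field.
    by rewrite gq expf_neq0.
  have inS k : g * u ^+ (q ^ k) \in s.
    elim: k => [|k IHk]; first by rewrite expn0 expr1 mulrC divfK.
    by rewrite expnSr exprM; apply: step.
  have [k [l [kl]]] := pigeonhole inS => /(mulfI g0) e.
  have qkl : (q ^ k < q ^ l)%N by rewrite ltn_exp2l // /q; nia.
  exists (q ^ l - q ^ k)%N; first by rewrite subn_gt0.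
  rewrite -(subnK (ltnW qkl)) exprD in e.
  by apply: (mulIf (expf_neq0 (q ^ k) u0)); rewrite -e mul1r.
move: one; elim: {hs}s => [|a s IHs] one; first by exists 1%N.
have [N N0 aN] := one a (mem_head _ _).
have [|M M0 sM] := IHs.
  by move=> b bs; apply: one; rewrite in_cons bs orbT.
exists (N * M)%N; first by rewrite muln_gt0 N0.
move=> b; rewrite in_cons => /orP[/eqP->|/sM bM].
  by rewrite exprM aN expr1n.
by rewrite mulnC exprM bM expr1n.
Qed.

(** All eigenvalues have the same [N]-th power [g ^+ N], which the determinant forces to be a root
    of unity. Cayley-Hamilton then gives nilpotency. *)
Lemma unipotent_power A c :
  A \is a GRing.unit -> (\det A) ^+ 2 = 1 ->
  (forall x, peval f (A *m x) = c * peval f x) ->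
  exists2 M, (0 < M)%N & (A ^+ M - 1) ^+ n = 0.
Proof.
move=> uA dA fA; have c0 := semi_invariant_neq0 uA fA.
have [r er] := closed_field_poly_normal (char_poly A).
move: er; rewrite (monicP (char_poly_monic A)) scale1r => er.
have sr : size r = n.
  by have := size_char_poly A; rewrite er size_prod_XsubC => -[].
pose g := d.-root c; have gd : g ^+ d = c by rewrite rootCK //; lia.
have g0 : g != 0.
  by apply: contraNneq c0 => g0; rewrite -gd g0 expr0n; case: (d) d_ge3.
have [N N0 hN] : exists2 N, (0 < N)%N & forall a, a \in r -> (a / g) ^+ N = 1.
  apply: finite_orbit_root_of_unity gd c0 _ => a.
  by rewrite -!root_prod_XsubC -er; apply: eigenvalue_semi_invariant.
have rN a : a \in r -> a ^+ N = g ^+ N.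
  by move=> /hN; rewrite expr_div_n => /divr1_eq.
(* The squared product of the [n] eigenvalues is [\det A ^+ 2 = 1]; take its [N]-th power. *)
have gM : (g ^+ N) ^+ (2 * n) = 1.
  have e : \prod_(a <- r) ('X - a%:P).[0] = (-1) ^+ n * \det A.
    by rewrite -char_poly_det er -horner_coef0 horner_prod.
  have : (\prod_(a <- r) ('X - a%:P).[0]) ^+ 2 ^+ N = 1.
    suff -> : (\prod_(a <- r) ('X - a%:P).[0]) ^+ 2 = 1 by rewrite expr1n.
    by rewrite e exprMn dA mulr1 -exprM mulnC exprM sqrrN !expr1n.
  rewrite -!prodrXl (eq_big_seq (fun=> (g ^+ N) ^+ 2)) => [|a ra].
    by rewrite big_const_seq count_predT iter_mulr_1 sr -exprM.
  by rewrite hornerXsubC sub0r sqrrN -(rN a ra) -!exprM mulnC.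
exists (N * (2 * n))%N; first by rewrite !muln_gt0 N0.
set M := (N * _)%N.
(* One factor ['X^M - 1] is spent per root, which accounts for multiplicities. *)
have : \prod_(a <- r) ('X - a%:P) %| ('X^M - 1%:P) ^+ size r.
  have : forall a, a \in r -> a ^+ M = 1 by move=> a /rN aN; rewrite exprM aN.
  elim: (r) => [|a s IHs] rM; first by rewrite big_nil expr0.
  rewrite big_cons exprS dvdp_mul ?IHs //.
    by rewrite dvdp_XsubCl rootE !hornerE rM ?mem_head // subrr.
  by move=> b bs; apply: rM; rewrite in_cons bs orbT.
rewrite -er sr => /dvdpP[q eq].
have := congr1 (horner_mx A) eq.
rewrite rmorphM /= Cayley_Hamilton mulr0 rmorphXn /= rmorphB /= rmorphXn /=.
by rewrite horner_mx_X horner_mx_C.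
Qed.

(* Along the orbit [S^k e], [grad f] grows like [k^(m (d - 1))] when
   [(S - 1)^m e] is the last nonzero iterate, whereas [grad f (S^k e) =
   grad f e * S^-k] grows at most like [k^m]. *)
Lemma unipotent_automorphism S c k :
  S \is a GRing.unit -> (S - 1) ^+ k = 0 ->
  (forall x, peval f (S *m x) = c * peval f x) -> S = 1.
Proof.
move=> uS Sk fS; apply/eqP; rewrite -subr_eq0; set N := S - 1 in Sk *.
apply/negPn/negP => N0.
have exk : exists k, N ^+ k == 0 by exists k; apply/eqP.
case: (ex_minnP exk) => {Sk}k /eqP Nk mink.
have [m ek m0] : exists2 m, k = m.+1 & (0 < m)%N.
  case: k Nk mink => [|[|m]]; first by move=> /eqP; rewrite expr0 oner_eq0.
    by move=> /eqP; rewrite expr1 (negPf N0).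
  by move=> *; exists m.+1.
subst k; have Nm : N ^+ m != 0 by apply/negP => /mink; rewrite ltnn.
have [e ze] : exists e : 'cV[K]_n, N ^+ m *m e != 0.
  apply: contrapT => /forallNP h; case/negP: Nm; apply/eqP.
  apply/matrixP => i j; have := h (delta_mx j ord0).
  by move=> /negP; rewrite negbK -colE => /eqP/colP/(_ i); rewrite !mxE.
set z := N ^+ m *m e in ze.
have d0 : (0 < d)%N by lia.
have Nz : N *m z = 0 by rewrite mulmxA mulmxE -exprS Nk mul0mx.
have Sz : S *m z = z.
  by rewrite -[S](subrK 1) mulmxDl Nz add0r mul1mx.
(* At the fixed vector [z], [grad f z] is a row eigenvector of the nilpotent [N] for the eigenvalue
   [c - 1]. *)
have c1 : c = 1.
  have w0 := grad_neq0 hf d0 sf ze; have := grad_chain z fS.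
  rewrite Sz; move: (grad f z) w0 => w w0 wS.
  have wN : w *m N = (c - 1) *: w.
    by rewrite mulmxBr mulmx1 wS scalerBl scale1r.
  have wNk j : w *m N ^+ j = (c - 1) ^+ j *: w.
    elim: j => [|j IHj]; first by rewrite !expr0 mulmx1 scale1r.
    by rewrite exprS -mulmxE mulmxA wN -scalemxAl IHj scalerA exprS.
  have := wNk m.+1; rewrite Nk mulmx0 => /esym/eqP.
  by rewrite scaler_eq0 (negPf w0) orbF expf_eq0 subr_eq0 => /andP[_ /eqP].
have fSk j x : peval f (S ^+ j *m x) = 1 * peval f x.
  elim: j => [|j IHj]; first by rewrite expr0 mul1mx mul1r.
  by rewrite exprS -mulmxE -mulmxA fS c1 mul1r IHj.
(* [N'] equals [- S^-1 N], so it is nilpotent of the same order and [S^-k] also expands into [m + 1]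
   binomial terms. *)
pose w := grad f e; pose N' := S^-1 - 1.
have N'k : N' ^+ m.+1 = 0.
  have eN' : N' = - (S^-1 * N) by rewrite mulrBr mulVr // mulr1 opprB.
  have cSN : GRing.comm S^-1 N.
    apply/commr_sym/commrV/commr_sym; apply: commrB; last exact: commr1.
    exact: commr_refl.
  by rewrite eN' exprNn exprMn_comm // Nk !mulr0.
have Skx j : S ^+ j *m e = \sum_(i < m.+1) (N ^+ i *m e) *+ 'C(j, i).
  rewrite -[S](subrK 1) addrC (exprD1_nilp _ Nk) mulmx_suml.
  by apply: eq_bigr => i _; rewrite -[in LHS]scaler_nat -scalemxAl scaler_nat.
have wSk j : grad f (S ^+ j *m e) = \sum_(i < m.+1) (w *m N' ^+ i) *+ 'C(j, i).
  have := grad_chain e (fSk j); rewrite scale1r => wj.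
  have -> : grad f (S ^+ j *m e) = w *m (S^-1) ^+ j.
    have SV : S ^+ j *m S^-1 ^+ j = 1%:M.
      by rewrite mulmxE exprVn mulrV // unitrX.
    by rewrite /w -wj -[RHS]mulmxA SV mulmx1.
  rewrite -[S^-1](subrK 1) [_ + 1]addrC (exprD1_nilp _ N'k) mulmx_sumr.
  by apply: eq_bigr => i _; rewrite -[in LHS]scaler_nat -scalemxAr scaler_nat.
(* The coordinates of [S^k e] and of [grad f e * S^-k], as polynomials in [k]. *)
pose P (i : 'I_n) : {poly K} :=
  \sum_(j < m.+1) (N ^+ j *m e) i ord0 *: binp K j.
pose Q (i : 'I_n) : {poly K} :=
  \sum_(j < m.+1) (w *m N' ^+ j) ord0 i *: binp K j.
have PQ i : substp P (mderiv i f) = Q i.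
  apply: poly_eq_nat => j; rewrite horner_substp horner_sum.
  have <- : (grad f (S ^+ j *m e)) ord0 i = \sum_(i0 < m.+1)
      ((w *m N' ^+ i0) ord0 i *: binp K i0).[j%:R].
    rewrite wSk summxE; apply: eq_bigr => l _.
    by rewrite hornerZ horner_binp mulr_natr mulmxnE.
  rewrite mxE; apply: meval_eq => l; rewrite Skx horner_sum summxE.
  by apply: eq_bigr => l' _; rewrite hornerZ horner_binp mulr_natr mulmxnE.
(* The vector [z / m!] collects the coefficients of [k^m] in [P]. Its gradient is therefore the
   coefficient of degree [m (d - 1)] in [Q], which is zero because [Q] has degree at most
   [m < m (d - 1)]. *)
have : grad f ((m`!%:R)^-1 *: z) != 0.
  apply: (grad_neq0 hf d0 sf); rewrite scaler_eq0 invr_eq0 negb_or ze andbT.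
  by rewrite pnatr_eq0 -lt0n fact_gt0.
case/negP; apply/eqP/rowP => i; rewrite mxE [RHS]mxE.
have hP l : has_top m (P l) (((m`!%:R)^-1 *: z) l ord0).
  rewrite mxE mulrC.
  exact: (has_top_binp_sum m (fun j => (N ^+ j *m e) l ord0)).
rewrite /peval; have [_ <-] := has_top_substp (homogeneous_mderiv i hf) hP.
rewrite PQ; have [sQ _] := has_top_binp_sum m (fun j => (w *m N' ^+ j) ord0 i).
by rewrite nth_default // (leq_trans sQ) //; nia.
Qed.

Lemma automorphism_torsion A :
  A \is a GRing.unit -> (\det A) ^+ 2 = 1 ->
  (forall z, peval f (A *m z) = 0 -> peval f z = 0) ->
  exists2 M, (0 < M)%N & A ^+ M = 1.
Proof.
move=> uA dA fA; have [m [c [m0 fm]]] := semi_invariant_power uA fA.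
have um : A ^+ m \is a GRing.unit by rewrite unitrX.
have [|M M0 hM] := unipotent_power um _ fm.
  have -> : \det (A ^+ m) = \det A ^+ m.
    elim: (m) => [|j IHj]; first by rewrite !expr0 det1.
    by rewrite !exprS -mulmxE det_mulmx IHj.
  by rewrite -exprM mulnC exprM dA expr1n.
exists (m * M)%N; first by rewrite muln_gt0 m0.
rewrite exprM; apply: (@unipotent_automorphism _ (c ^+ M) n) => // [|x].
  by rewrite unitrX.
elim: (M) => [|j IHj]; first by rewrite !expr0 mul1mx mul1r.
by rewrite exprS -mulmxE -mulmxA fm IHj exprS mulrA.
Qed.

End LinearAutomorphisms.

(** * Smooth hypersurfaces and hyperplane arrangements *)

(** Two stacked forms make a matrix of rank at most [2 < n]. *)
Lemma common_kernel (F : fieldType) n (l1 l2 : 'rV[F]_n) :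
  (3 <= n)%N -> exists z : 'cV[F]_n, [/\ z != 0, l1 *m z = 0 & l2 *m z = 0].
Proof.
move=> n3; pose M := col_mx l1 l2.
have /rowV0Pn[u /sub_kermxP uM u0] : kermx M^T != 0.
  rewrite kermx_eq0 /row_free neq_ltn.
  by rewrite (leq_ltn_trans (rank_leq_col _)).
exists u^T; rewrite trmx_eq0 u0.
have : M *m u^T = 0 by rewrite -[M]trmxK -trmx_mul uM trmx0.
by rewrite mul_col_mx -[0]vsubmxK => /eq_col_mx[-> ->]; rewrite !linear0.
Qed.

(* Restricting to the lines in a fixed direction shows that [f] is a product of
   linear forms; it is then singular where two of them vanish. *)
Lemma hypersurface_not_in_hyperplanes (K : numClosedFieldType) n d
    (f : mpoly n K) (L : seq 'rV[K]_n) :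
  homogeneous d f -> (2 <= d)%N -> (3 <= n)%N -> nonsingular f ->
  (forall l, l \in L -> l != 0) ->
  ~ (forall z, peval f z = 0 -> exists2 l, l \in L & (l *m z) ord0 ord0 = 0).
Proof.
move=> hf d2 n3 sf L0 fL.
pose l (i : 'I_(size L)) (y : 'cV[K]_n) := (nth 0 L i *m y) ord0 ord0.
have ll i : line_poly (l i) by apply: line_poly_linear.
(* Adjoining [f] to the linear forms yields a direction [v] off all the hyperplanes and off the
   hypersurface. *)
pose F (o : option 'I_(size L)) := if o is Some i then l i else peval f.
have lF o : line_poly (F o) by case: o => // ; apply: line_poly_peval.
have nF o : exists x, F o x != 0.
  case: o => [i|] /=; last by apply: nonsingular_neq0 => //; lia.
  apply: contrapT => /forallNP h.
  have /eqP := L0 _ (mem_nth 0 (ltn_ord i)); apply.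
  apply: row_ext => v; rewrite mul0mx [RHS]mxE.
  by have /negP := h v; rewrite negbK => /eqP.
have [v hv] := common_nonzero lF nF.
have fv : peval f v != 0 := hv None.
have lv i : l i v != 0 := hv (Some i).
pose T := {ffun 'I_d -> 'I_(size L)}.
(* The function [t] assigns one linear form to each of the [d] roots; the factors are normalized to
   be [1] at [v]. *)
pose G (t : T) y :=
  peval f y - peval f v * \prod_(j < d) (l (t j) y / l (t j) v).
have lG t : line_poly (G t).
  apply: line_polyB; first exact: line_poly_peval.
  apply: line_polyM; first exact: line_polyC.
  apply: line_poly_prod => j; apply: line_polyM => //; exact: line_polyC.
have zG y : exists t, G t y = 0.
  have [r hr] := line_split y hf fv.
  (* The root [r_j] puts [y + r_j v] on some hyperplane [l = 0], whence [- r_j = l(y) / l(v)]. *)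
  have /choice[t ht] j : exists i, l i y = - (tnth r j * l i v).
    have [u uL] := fL _ (line_split_root j hr).
    have iu : (index u L < size L)%N by rewrite index_mem.
    rewrite mulmxDr -scalemxAr !mxE => /eqP; rewrite addr_eq0 => /eqP e.
    by exists (Ordinal iu); rewrite /l /= nth_index // !mxE.
  exists [ffun j => t j]; apply/eqP; rewrite subr_eq0; apply/eqP.
  have := hr 0; rewrite scale0r addr0 => ->; congr (_ * _).
  by apply: eq_bigr => j _; rewrite ffunE ht mulNr mulfK // sub0r.
have [t ht] := vanishing_factor lG zG.
have {ht}ft y : peval f y = peval f v * \prod_(j < d) (l (t j) y / l (t j) v).
  by have /eqP := ht y; rewrite subr_eq0 => /eqP.
have d0 : (0 < d)%N by lia.
pose j0 := Ordinal d0; pose j1 := Ordinal d2.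
(* The two forms may coincide; what counts is that two distinct factors of the product vanish at
   [z], so its derivative there is zero. *)
have [z [z0 lz0 lz1]] := common_kernel (nth 0 L (t j0)) (nth 0 L (t j1)) n3.
have /eqP := grad_neq0 hf d0 sf z0; apply; apply: row_ext => y.
rewrite mul0mx [RHS]mxE -deriv_line.
pose p j : {poly K} :=
  (l (t j) z / l (t j) v)%:P + (l (t j) y / l (t j) v) *: 'X.
have -> : line f z y = (peval f v)%:P * \prod_(j < d) p j.
  apply: poly_eq_fun => a; rewrite horner_line ft hornerM hornerC horner_prod.
  congr (_ * _); apply: eq_bigr => j _.
  have -> : l (t j) (z + a *: y) = l (t j) z + a * l (t j) y.
    by rewrite /l mulmxDr -scalemxAr mxE [X in _ + X]mxE.
  by rewrite /p !hornerE; field; apply: lv.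
have p0 j : nth 0 L (t j) *m z = 0 -> (p j).[0] = 0.
  by move=> e; rewrite /p /l e !hornerE mxE mul0r.
clearbody p; rewrite (bigD1 j0) //= (bigD1 j1) //= !derivM.
rewrite !(hornerD, hornerM) ?(p0 j0 lz0) ?(p0 j1 lz1).
by rewrite !(mul0r, mulr0, addr0).
Qed.

(** * Torsion groups of integer matrices *)

Section TorsionIntegerMatrices.
Variable n' : nat.
Let n := n'.+1.
Implicit Types (T N B : 'M[int]_n).

Lemma matrix_mulrn_eq0 (N : 'M[int]_n) M : (0 < M)%N -> N *+ M = 0 -> N = 0.
Proof.
move=> M0 /matrixP h; apply/matrixP => i j; have := h i j.
rewrite mulmxnE !mxE => /eqP; rewrite mulrn_eq0 eqn0Ngt M0 /=.
by move/eqP.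
Qed.

(** The nilpotency order is lowered step by step: if [N^(k+2) = 0], then
    [N^k (1 + N)^M = N^k + M N^(k+1)], so [M N^(k+1) = 0]. *)
Lemma nilpotent_torsion N k M :
  N ^+ k = 0 -> (0 < M)%N -> (1 + N) ^+ M = 1 -> N = 0.
Proof.
move=> Nk M0 NM; elim: k Nk => [/eqP|k IHk Nk]; first by rewrite expr0 oner_eq0.
case: k => [|k] in IHk Nk *; first by rewrite expr1 in Nk.
apply: IHk; apply: (matrix_mulrn_eq0 M0).
have h j : N ^+ k * (1 + N) ^+ j = N ^+ k + N ^+ k.+1 *+ j.
  elim: j => [|j IHj]; first by rewrite expr0 mulr1 mulr0n addr0.
  rewrite exprSr mulrA IHj mulrDr mulr1 mulrDl mulrnAl -!exprSr Nk mul0rn addr0.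
  by rewrite -addrA mulrSr.
have := h M; rewrite NM mulr1 => /eqP.
by rewrite eq_sym addrC -subr_eq0 addrK => /eqP.
Qed.

(* The powers of [T] are bounded, so the entries of [(T - 1)^k] are at most
   [2^k C]; being divisible by [3^k], they vanish for large [k]. *)
Lemma torsion_congr1_mod3 T B M :
  (0 < M)%N -> T ^+ M = 1 -> T = 1 + B *+ 3 -> T = 1.
Proof.
move=> M0 TM TB; set N := B *+ 3 in TB.
pose C := (\sum_(j < M) \sum_a \sum_b `|(T ^+ j) a b|)%N.
have bT j a b : (`|(T ^+ j) a b| <= C)%N.
  have -> : T ^+ j = T ^+ (j %% M).
    by rewrite {1}(divn_eq j M) exprD mulnC exprM TM expr1n mul1r.
  rewrite /C (bigD1 (Ordinal (ltn_pmod j M0))) //= (bigD1 a) //= (bigD1 b) //=.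
  lia.
(* Since [N = T - 1], each factor [N] gives a difference of two terms with shifted [j]; hence the
   generalization over [j] and the factor [2 ^ k]. *)
have bN k : forall j a b, (`|(N ^+ k * T ^+ j)%R a b| <= 2 ^ k * C)%N.
  elim: k => [|k IHk] j a b; first by rewrite expr0 mul1r expn0 mul1n.
  have -> : N ^+ k.+1 * T ^+ j = N ^+ k * T ^+ j.+1 - N ^+ k * T ^+ j.
    have NE : N = T - 1 by rewrite TB addrC addKr.
    by rewrite exprSr -mulrA -mulrBr {2}NE mulrBl mul1r -exprS.
  have := IHk j.+1 a b; have := IHk j a b; rewrite !mxE expnS; lia.
(* Bernoulli's inequality for [(3/2)^k]. At [k = 2 C] it gives [2^k C < 3^k]. *)
have bern k : (2 ^ k * (k + 2) <= 2 * 3 ^ k)%N.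
  by elim: k => // k; rewrite !expnS; nia.
have Nk : N ^+ (2 * C) = 0.
  have e : N ^+ (2 * C) = B ^+ (2 * C) *+ 3 ^ (2 * C).
    exact: exprMn_n.
  apply/matrixP => a b; rewrite [RHS]mxE; apply/eqP.
  have := bN (2 * C)%N 0%N a b; rewrite expr0 mulr1 e mulmxnE.
  move: (bern (2 * C)%N) => h; set x := (B ^+ _) a b.
  rewrite -mulr_natr abszM natz /= => h'.
  have : (0 < 2 ^ (2 * C))%N by rewrite expn_gt0.
  case: (eqVneq x 0) => [->|]; first by rewrite mul0r.
  rewrite -absz_gt0; nia.
by rewrite TB (nilpotent_torsion Nk M0) ?addr0 // -TB.
Qed.

(** Reduction modulo 3 is injective on [G]: if [S] and [T] agree modulo 3, then [S T^-1] is a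
    torsion element congruent to [1]. *)
Lemma torsion_subgroup_finite (G : set 'M[int]_n) :
  is_subgroup G -> (forall T, G T -> exists2 M, (0 < M)%N & T ^+ M = 1) ->
  finite_set G.
Proof.
move=> [GL G1 GM GV] tG.
pose red T : 'M['I_3]_n := \matrix_(i, j) inord `|(T i j %% 3)%Z|.
(* A representative in [G] of each residue matrix; the default [1] is taken where there is none. *)
pose lift (m : 'M['I_3]_n) : 'M[int]_n := xget 1 [set T | G T /\ red T = m].
suff sub : G `<=` lift @` setT.
  by apply: sub_finite_set sub _; apply: finite_image; apply: finite_finset.
move=> T GT; exists (red T) => //; rewrite /lift.
case: xgetP => [S _ [GS ST]|/(_ T)]; last by case.
have uT : T \is a GRing.unit.
  rewrite -[X in is_true X]/(T \in unitmx) unitmxE.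
  by case: (GL _ GT) => ->; rewrite ?unitrN1 ?unitr1.
have [B hB] : exists B : 'M[int]_n, S - T = B *+ 3.
  exists (map_mx (fun x => (x %/ 3)%Z) (S - T)); apply/matrixP => i j.
  have := congr1 (fun m : 'M['I_3]_n => val (m i j)) ST.
  rewrite mulmxnE !mxE /= !inordK; lia.
have [M M0 STM] := tG _ (GM _ _ GS (GV _ GT)).
have ST1 : S * T^-1 = 1.
  apply: (@torsion_congr1_mod3 _ (B * T^-1) M) => //.
  by rewrite -mulrnAl -hB mulrBl divrr // addrC subrK.
by rewrite -[LHS](mulrVK uT) ST1 mul1r.
Qed.

End TorsionIntegerMatrices.

(** * Polyhedral cones *)

Section PolyhedralCones.
Variables (R : realType) (n : nat).
Implicit Types (C : set 'cV[R]_n) (x y v p : 'cV[R]_n) (l : 'rV[R]_n).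
Implicit Types (s : seq 'cV[R]_n) (L : seq 'rV[R]_n).

Definition dot l x : R := (l *m x) ord0 ord0.

Lemma dotDr l x y : dot l (x + y) = dot l x + dot l y.
Proof. by rewrite /dot mulmxDr mxE. Qed.

Lemma dotZr l a x : dot l (a *: x) = a * dot l x.
Proof. by rewrite /dot -scalemxAr mxE. Qed.

Lemma dotDl l l' x : dot (l + l') x = dot l x + dot l' x.
Proof. by rewrite /dot mulmxDl mxE. Qed.

Lemma dotZl a l x : dot (a *: l) x = a * dot l x.
Proof. by rewrite /dot -scalemxAl mxE. Qed.

Lemma dot_delta i x : dot (delta_mx ord0 i) x = x i ord0.
Proof. by rewrite /dot -rowE mxE. Qed.

(** Nonnegative combinations of [s], one generator being split off at a time as elimination
    requires. *)
Fixpoint cone s x : Prop :=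
  if s is v :: s' then exists2 t, 0 <= t & cone s' (x - t *: v) else x = 0.

Lemma cone0 s : cone s 0.
Proof. by elim: s => //= v s IHs; exists 0; rewrite // scale0r subr0. Qed.

Lemma coneD s x y : cone s x -> cone s y -> cone s (x + y).
Proof.
elim: s x y => [|v s IHs] x y /=; first by move=> -> ->; rewrite addr0.
move=> [t t0 hx] [u u0 hy]; exists (t + u); first exact: addr_ge0.
by rewrite scalerDl opprD addrACA; apply: IHs.
Qed.

Lemma coneZ s a x : 0 <= a -> cone s x -> cone s (a *: x).
Proof.
move=> a0; elim: s x => [|v s IHs] x /=; first by move=> ->; rewrite scaler0.
move=> [t t0 /IHs hx]; exists (a * t); first exact: mulr_ge0.
by rewrite -scalerA -scalerBr.
Qed.

Lemma cone_mem s v : v \in s -> cone s v.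
Proof.
elim: s => //= w s IHs; rewrite in_cons => /orP[/eqP->|/IHs hv].
  by exists 1; rewrite // scale1r subrr; apply: cone0.
by exists 0; rewrite // scale0r subr0.
Qed.

Lemma cone_sub C s x :
  convex_cone C -> (forall v, v \in s -> C v) -> cone s x -> C x.
Proof.
move=> [[x0 Cx0] CC]; elim: s x => [|v s IHs] x hs /=.
  move=> ->; have := CC 0 0 _ _ (lexx _) (lexx _) Cx0 Cx0.
  by rewrite !scale0r addr0.
move=> [t t0 /IHs hx].
have -> : x = 1 *: (x - t *: v) + t *: v by rewrite scale1r subrK.
apply: CC => //; last by apply: hs; rewrite mem_head.
by apply: hx => w ws; apply: hs; rewrite in_cons ws orbT.
Qed.

Lemma seq_max (s : seq R) :
  exists t, [/\ t = 0 \/ t \in s, 0 <= t & forall a, a \in s -> a <= t].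
Proof.
elim: s => [|b s [t [ht t0 st]]]; first by exists 0; split=> //; left.
have [bt|tb] := leP b t.
  exists t; split=> //.
    by case: ht => [->|ts]; [left|right; rewrite in_cons ts orbT].
  by move=> a; rewrite in_cons => /orP[/eqP->|/st].
exists b; split; first by right; rewrite mem_head.
  exact: le_trans (ltW tb).
move=> a; rewrite in_cons => /orP[/eqP->//|/st /le_trans]; apply.
exact: ltW.
Qed.

(* Fourier-Motzkin elimination of the coefficient of each generator. *)
Lemma cone_halfspaces s :
  exists L, forall x, cone s x <-> (forall l, l \in L -> 0 <= dot l x).
Proof.
elim: s => [|v s [L IH]] /=.
  (* The zero cone is cut out by the coordinate forms and their opposites. *)
  pose E := [seq delta_mx ord0 i | i <- enum 'I_n] : seq 'rV[R]_n.
  exists (E ++ [seq (-1) *: l | l <- E]) => x; split=> [-> l _|h].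
    by rewrite /dot mulmx0 mxE.
  apply/colP => i; rewrite mxE.
  have iE : delta_mx ord0 i \in E by apply: map_f; rewrite mem_enum.
  have := h (delta_mx ord0 i); rewrite mem_cat iE dot_delta => /(_ isT) h1.
  have := h ((-1) *: delta_mx ord0 i).
  rewrite mem_cat (map_f _ iE) orbT dotZl dot_delta => /(_ isT) h2; lra.
pose neg := [seq l <- L | dot l v < 0]; pose pos := [seq l <- L | 0 < dot l v].
(* Forms nonnegative on [v] are kept; each pair of opposite signs is combined into a form that
   vanishes on [v]. *)
exists ([seq l <- L | 0 <= dot l v] ++
  [seq dot l2 v *: l1 + (- dot l1 v) *: l2 | l1 <- neg, l2 <- pos]) => x; split.
  move=> [t t0 /IH h] l.
  have {}h l' : l' \in L -> 0 <= dot l' x - t * dot l' v.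
    by move=> /h; rewrite -scaleNr dotDr dotZr mulNr.
  rewrite mem_cat mem_filter => /orP[/andP[lv /h]|]; first by nra.
  move=> /allpairsP[[l1 l2] /= []]; rewrite !mem_filter.
  move=> /andP[v1 /h h1] /andP[v2 /h h2] ->; rewrite dotDl !dotZl; nra.
move=> h.
have hpos l : l \in L -> 0 <= dot l v -> 0 <= dot l x.
  by move=> lL lv; apply: h; rewrite mem_cat mem_filter lv lL.
have hpair l1 l2 : l1 \in L -> l2 \in L -> dot l1 v < 0 -> 0 < dot l2 v ->
    0 <= dot l2 v * dot l1 x - dot l1 v * dot l2 x.
  move=> L1 L2 v1 v2.
  have := h (dot l2 v *: l1 + (- dot l1 v) *: l2).
  rewrite dotDl !dotZl mulNr; apply.
  rewrite mem_cat; apply/orP; right.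
  by apply: allpairs_f; rewrite mem_filter ?v1 ?v2.
(* Forms negative on [v] bound its coefficient from below, positive ones from above. The largest
   lower bound, with [0] included, is taken, and [hpair] keeps it below the upper ones. *)
have [t [ht t0 st]] := seq_max [seq dot l x / dot l v | l <- neg].
exists t => //; apply/IH => l lL; rewrite -scaleNr dotDr dotZr mulNr subr_ge0.
have [lv|lv|lv] := ltrgt0P (dot l v); last by rewrite lv mulr0 hpos ?lv.
  rewrite -ler_pdivlMr //; case: ht => [->|].
    by rewrite divr_ge0 ?hpos // ltW.
  move=> /mapP[l1]; rewrite mem_filter => /andP[v1 L1] ->.
  rewrite ler_pdivlMr // mulrAC ler_ndivrMr //.
  by have := hpair _ _ L1 lL v1 lv; rewrite subr_ge0 mulrC [X in _ <= X]mulrC.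
rewrite -ler_ndivrMr //; apply: st.
by apply: map_f; rewrite mem_filter lv.
Qed.

(** * Neighbourhoods, interior points and rational points of a cone *)

Lemma nbhs_cV x (A : set 'cV[R]_n) :
  nbhs x A <->
  exists2 e, 0 < e & forall y, (forall i, `|x i ord0 - y i ord0| < e) -> A y.
Proof.
split=> [/nbhs_ballP[e e0 h]|[e e0 h]]; [|apply/nbhs_ballP]; exists e => //.
  move=> y xy; apply: h; split=> // i j; rewrite (ord1 j).
  by rewrite -ball_normE /=; apply: xy.
move=> y [_ xy]; apply: h => i; have := xy i ord0.
by rewrite -ball_normE.
Qed.

Lemma dot_near l x (e : R) :
  0 < e -> \forall y \near x, `|dot l x - dot l y| < e.
Proof.
move=> e0; pose B := 1 + \sum_i `|l ord0 i|.
have B1 : 1 <= B by rewrite lerDl sumr_ge0.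
have B0 : 0 < B by apply: lt_le_trans B1.
apply/nbhs_cV; exists (e / B); first by rewrite divr_gt0.
move=> y xy.
have -> : dot l x - dot l y = \sum_i l ord0 i * (x i ord0 - y i ord0).
  by rewrite /dot !mxE -sumrB; apply: eq_bigr => i _; rewrite mulrBr.
apply: le_lt_trans (ler_norm_sum _ _ _) _.
apply: (@le_lt_trans _ _ ((B - 1) * (e / B))); last first.
  by rewrite mulrA ltr_pdivrMr // mulrC ltr_pM2l // ltrBlDr ltrDl.
rewrite /B addrC addKr mulr_suml; apply: ler_sum => i _.
by rewrite normrM ler_wpM2l // ltW.
Qed.

Lemma mulmx_near (A : 'M[R]_n) x (U : set 'cV[R]_n) :
  nbhs (A *m x) U -> nbhs x [set y | U (A *m y)].
Proof.
move=> /nbhs_cV[e e0 h].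
have : \forall y \near x, forall i, `|dot (row i A) x - dot (row i A) y| < e.
  apply: (@filter_forall _ _
    (fun i y => `|dot (row i A) x - dot (row i A) y| < e) (nbhs x) (nbhs_filter x)).
  by move=> i; apply: dot_near.
apply: filterS => y hy; apply: h => i; have := hy i.
by rewrite /dot -!row_mul !mxE.
Qed.

(** A list in [C] with span of maximal dimension spans the whole space; the sum of its members is an
    interior point. *)
Lemma full_dimensional_interior C :
  convex_cone C -> full_dimensional C -> exists p, nbhs p C.
Proof.
move=> CC Cfull.
pose P k := `[< exists2 s, (forall v, v \in s -> C v) & \dim <<s>>%VS = k >].
have exP : exists k, P k.
  by exists (\dim <<[::] : seq 'cV[R]_n>>%VS); apply/asboolP; exists [::].
have bP k : P k -> (k <= \dim {:'cV[R]_n})%N.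
  by move=> /asboolP[s _ <-]; apply: dimvS; apply: subvf.
case: (ex_maxnP exP bP) => k /asboolP[s sC sk] kmax.
have sfull : <<s>>%VS = fullv.
  apply: Cfull => x Cx.
  have : (\dim <<x :: s>>%VS <= k)%N.
    apply/kmax/asboolP; exists (x :: s) => // v.
    by rewrite in_cons => /orP[/eqP->|/sC].
  rewrite -sk => hdim.
  have : (<<s>> == <<x :: s>>)%VS.
    by rewrite eqEdim hdim span_cons addvSr.
  by move=> /eqP ->; rewrite memv_span // mem_head.
pose X := in_tuple s.
have full y : y = \sum_(i < size s) coord X i y *: X`_i.
  by apply: coord_span; rewrite sfull memvf.
pose lin i : 'rV[R]_n := \row_j coord X i (delta_mx j ord0).
have linE i y : coord X i y = dot (lin i) y.
  rewrite {1}(matrix_sum_delta y) linear_sum /dot mxE; apply: eq_bigr => j _.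
  by rewrite big_ord1 linearZ mxE mulrC.
exists (\sum_(i < size s) X`_i); set p := \sum_(i < _) _.
have : \forall y \near p, forall i, `|dot (lin i) p - dot (lin i) y| < 1.
  apply: (@filter_forall _ _
    (fun i y => `|dot (lin i) p - dot (lin i) y| < 1) (nbhs p) (nbhs_filter p)).
  by move=> i; apply: dot_near.
apply: filterS => y hy; apply: (cone_sub CC sC).
(* The list need not be free, so the coefficients of [y] are [1] plus the coordinates of the small
   vector [y - p]. *)
have -> : y = \sum_(i < size s) (1 + coord X i (y - p)) *: X`_i.
  under eq_bigr do rewrite scalerDl scale1r.
  by rewrite big_split /= -full -/p addrC subrK.
apply: (big_ind (cone s)) => [||i _]; [exact: cone0|exact: coneD|].
have {hy} : 0 <= 1 + coord X i (y - p).
  by have := hy i; rewrite linearB /= !linE ltr_norml; lra.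
move=> /coneZ; apply; apply: cone_mem; exact: mem_nth.
Qed.

(** Moving [x] slightly towards the interior point [p] gives a point [q] with a whole ball in [C]; a
    rational point of that ball is then scaled to an integral one. *)
Lemma rational_approximation C x p (e : R) :
  convex_cone C -> nbhs p C -> C x -> 0 < e ->
  exists (M : nat) (z : 'cV[int]_n), let y := map_mx intr z : 'cV[R]_n in
    C y /\ forall i, `|x i ord0 - M.+1%:R^-1 * y i ord0| < e.
Proof.
move=> [_ CC] /nbhs_cV[e0 e0_gt0 hp] Cx e_gt0.
pose D := 1 + \sum_i `|p i ord0 - x i ord0|.
have D1 : 1 <= D by rewrite lerDl sumr_ge0.
have D0 : 0 < D by apply: lt_le_trans D1.
have bD i : `|p i ord0 - x i ord0| <= D.
  by rewrite /D (bigD1 i) //= addrCA lerDl addr_ge0 // sumr_ge0.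
(* Small enough that [q] is within [e / 2] of [x], and at most [1] for convexity. *)
pose t := Num.min 1 (e / (2 * D)).
have t0 : 0 < t by rewrite lt_min ltr01 divr_gt0 // mulr_gt0.
have t1 : t <= 1 by rewrite ge_min lexx.
have tD : t * D <= e / 2.
  have -> : e / 2 = e / (2 * D) * D by field; rewrite gt_eqF.
  by rewrite ler_pM2r // ge_min lexx orbT.
pose q := x + t *: (p - x).
have qC y : (forall i, `|q i ord0 - y i ord0| < t * e0) -> C y.
  move=> qy; have -> : y = (1 - t) *: x + t *: (p + t^-1 *: (y - q)).
    rewrite scalerDr scalerA divff ?gt_eqF // scale1r scalerBl.
    rewrite scale1r /q scalerBr.
    by apply/colP => i; rewrite !mxE; ring.
  apply: CC; rewrite ?subr_ge0 ?(ltW t0) //; apply: hp => i.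
  have eqp (q0 : 'cV[R]_n) : p i ord0 - (p + t^-1 *: (y - q0)) i ord0 =
      t^-1 * (q0 i ord0 - y i ord0) by rewrite !mxE; ring.
  rewrite eqp normrM gtr0_norm ?invr_gt0 // mulrC.
  by rewrite ltr_pdivrMr // [e0 * t]mulrC.
pose r := Num.min (t * e0) (e / 2).
have r0 : 0 < r by rewrite lt_min mulr_gt0 ?divr_gt0.
have [M] := ltr_add_invr r0; rewrite add0r => Mr.
have M0 : 0 < M.+1%:R :> R by rewrite ltr0n.
pose z : 'cV[int]_n := \col_i Num.floor (M.+1%:R * q i ord0).
have zq i : `|q i ord0 - M.+1%:R^-1 * (z i ord0)%:~R| < r.
  have -> : z i ord0 = Num.floor (M.+1%:R * q i ord0) by rewrite mxE.
  apply: le_lt_trans Mr; set a := M.+1%:R * _.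
  have -> : q i ord0 - M.+1%:R^-1 * (Num.floor a)%:~R =
      M.+1%:R^-1 * (a - (Num.floor a)%:~R).
    by rewrite mulrBr /a mulKf // gt_eqF.
  rewrite normrM gtr0_norm ?invr_gt0 // ler_piMr ?invr_ge0 ?(ltW M0) //.
  have := floor_itv a; rewrite intrD ler_norml; lra.
exists M, z => y; split=> [|i].
  have -> : y = M.+1%:R *: (M.+1%:R^-1 *: y) + 0 *: x.
    by rewrite scale0r addr0 scalerA divff ?gt_eqF // scale1r.
  apply: CC => //; apply: qC => i.
  have -> : (M.+1%:R^-1 *: y) i ord0 = M.+1%:R^-1 * (z i ord0)%:~R.
    by rewrite mxE [y i ord0]mxE.
  by have := zq i; rewrite lt_min => /andP[].
have := zq i; rewrite lt_min => /andP[_].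
have : `|x i ord0 - q i ord0| <= e / 2.
  rewrite !mxE opprD addrA subrr add0r normrN normrM gtr0_norm //.
  by apply: le_trans tD; rewrite ler_pM2l.
rewrite [y i ord0]mxE; move: (q i ord0) (x i ord0) (_^-1 * _) => a b c h1 h2.
apply: le_lt_trans (ler_distD a _ _) _; lra.
Qed.

(** By rational approximation [C] lies in the half-spaces that cut out [cone s]. At a point of [C]
    where all the nonzero forms are positive they stay positive nearby, so that point is
    interior. *)
Lemma boundary_in_hyperplanes C s :
  convex_cone C -> closed C -> full_dimensional C ->
  (forall v, v \in s -> C v) -> (forall x, lattice_points C x -> cone s x) ->
  exists L, (forall l, l \in L -> l != 0) /\
    (forall x, boundary C x -> exists2 l, l \in L & dot l x = 0).
Proof.
move=> CC Ccl Cfull sC latC; have [p Cp] := full_dimensional_interior CC Cfull.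
have [L0 hL0] := cone_halfspaces s.
have CL x l : C x -> l \in L0 -> 0 <= dot l x.
  move=> Cx lL; rewrite leNgt; apply/negP => lx.
  have e0 : 0 < - dot l x by rewrite oppr_gt0.
  have /nbhs_cV[e e_gt0 he] := dot_near l x e0.
  have [M [z [Cz zx]]] := rational_approximation CC Cp Cx e_gt0.
  set y : 'cV[R]_n := map_mx intr z in Cz zx.
  have /hL0 /(_ l lL) ly : cone s y by apply: latC; split=> //; exists z.
  have := he (M.+1%:R^-1 *: y); rewrite dotZr => h.
  have {}h : `|dot l x - M.+1%:R^-1 * dot l y| < - dot l x.
    by apply: h => i; have := zx i; rewrite [in X in _ -> X]mxE.
  have : 0 <= M.+1%:R^-1 * dot l y by rewrite mulr_ge0 // invr_ge0.
  move: (_ * dot l y) h => w; rewrite ltr_norml => /andP[h _] w0; lra.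
exists [seq l <- L0 | l != 0]; split=> [l|x [clx nix]].
  by rewrite mem_filter => /andP[].
have Cx : C x by apply: Ccl.
apply: contrapT => noL; apply: nix; rewrite /interior /=.
have : \forall y \near x, forall i : 'I_(size L0), 0 <= dot (nth 0 L0 i) y.
  apply: (@filter_forall _ 'I_(size L0)
    (fun i y => 0 <= dot (nth 0 L0 i) y) (nbhs x) (nbhs_filter x)) => i.
  set l := nth 0 L0 i.
  have lL : l \in L0 by apply: mem_nth.
  have [->|l0] := eqVneq l 0.
    by apply: filterE => y; rewrite /dot mul0mx mxE.
  have lx : 0 < dot l x.
    rewrite lt_neqAle CL // andbT eq_sym; apply/eqP => lx0.
    by apply: noL; exists l => //; rewrite mem_filter l0.
  by apply: filterS (dot_near l x lx) => y; rewrite ltr_norml; lra.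
apply: filterS => y hy; apply: (cone_sub CC sC); apply/hL0 => l lL.
have il : (index l L0 < size L0)%N by rewrite index_mem.
by have := hy (Ordinal il); rewrite /= nth_index.
Qed.

End PolyhedralCones.

(** * The group action on the algebraic boundary *)

Section ZariskiClosure.
Variables (K : comNzRingType) (n : nat).

Definition linform (w : 'rV[K]_n) : mpoly n K :=
  \sum_j w ord0 j *: mpolyX K (mnm1 j).

Lemma peval_linform w z : peval (linform w) z = (w *m z) ord0 ord0.
Proof.
rewrite /peval /linform raddf_sum mxE; apply: eq_bigr => j _.
by rewrite /= mevalZ mevalXU.
Qed.

(** A polynomial vanishing on [E] still vanishes on [E] after composition with [A]. *)
Lemma zariski_closure_mulmx (A : 'M[K]_n) (E : set 'cV[K]_n) z :
  (forall x, E x -> E (A *m x)) ->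
  zariski_closure E z -> zariski_closure E (A *m z).
Proof.
move=> EA Ez p Ep; pose lq := [tuple linform (row i A) | i < n].
have compE x : peval (comp_mpoly lq p) x = peval p (A *m x).
  rewrite /peval comp_mpoly_meval; apply: meval_eq => i.
  rewrite tnth_mktuple -[LHS]/(peval (linform (row i A)) x) peval_linform.
  by rewrite -row_mul mxE.
have := Ez (comp_mpoly lq p); rewrite /zero_locus /= compE; apply.
by move=> x /EA /Ep; rewrite /zero_locus /= compE.
Qed.

End ZariskiClosure.

Section GroupAction.
Variables (R : realType) (n' : nat).
Let n := n'.+1.
Variables (C : set 'cV[R]_n) (G : set 'M[int]_n).
Hypotheses (C_closed : closed C) (G_group : is_subgroup G).
Hypothesis GC : orbit_set G C = C.

Lemma subgroup_unit T : G T -> T \is a GRing.unit.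
Proof.
case: G_group => GL _ _ _ GT.
rewrite -[X in is_true X]/(T \in unitmx) unitmxE.
by case: (GL _ GT) => ->; rewrite ?unitrN1 ?unitr1.
Qed.

Lemma subgroup_cone T x : G T -> C x -> C (act T x).
Proof. by move=> GT Cx; rewrite -GC; exists T => //; exists x. Qed.

Lemma map_mx_invK (F : pzRingType) T (x : 'cV[F]_n) :
  G T -> map_mx intr (invmx T) *m (map_mx intr T *m x) = x.
Proof.
move=> GT; rewrite mulmxA -map_mxM.
have -> : invmx T *m T = 1%:M by apply: mulVmx; apply: subgroup_unit.
by rewrite map_mx1 mul1mx.
Qed.

(** A neighbourhood of [act T x] inside [C] pulls back along [T] to one of [x], because the inverse
    of [T] also preserves [C]. *)
Lemma subgroup_boundary T x : G T -> boundary C x -> boundary C (act T x).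
Proof.
move=> GT [clx nix]; have [_ _ _ GV] := G_group; split.
  by apply: subset_closure; apply: subgroup_cone => //; apply: C_closed.
move=> /mulmx_near Tx; apply: nix; apply: filterS Tx => y Cy.
by rewrite -(map_mx_invK y GT); apply: subgroup_cone => //; apply: GV.
Qed.

(** The inverse of [T] preserves the real boundary, hence its Zariski closure, which is the zero
    locus of [f]. *)
Lemma subgroup_zero_locus (f : mpoly n R[i]) T (z : 'cV[R[i]]_n) :
  algebraic_boundary C = zero_locus f -> G T ->
  peval f (map_mx intr T *m z) = 0 -> peval f z = 0.
Proof.
move=> Cf GT fTz; have [_ _ _ GV] := G_group.
have : zero_locus f (map_mx intr T *m z) by [].
rewrite -Cf => /(@zariski_closure_mulmx _ _ (map_mx intr (invmx T))).
rewrite map_mx_invK // -/(algebraic_boundary C) Cf; apply.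
move=> _ [x bx <-]; exists (act (invmx T) x).
  by apply: subgroup_boundary => //; apply: GV.
rewrite /act map_mxM -map_mx_comp; congr (_ *m _).
by apply/matrixP => i j; rewrite !mxE /= rmorph_int.
Qed.

Lemma subgroup_torsion d (f : mpoly n R[i]) T :
  homogeneous d f -> (3 <= d)%N -> nonsingular f ->
  algebraic_boundary C = zero_locus f -> G T ->
  exists2 M, (0 < M)%N & T ^+ M = 1.
Proof.
move=> hf d3 sf Cf GT; pose A : 'M[R[i]]_n := map_mx intr T.
have dA : \det A ^+ 2 = 1.
  case: G_group => GL _ _ _; rewrite /A det_map_mx.
  by case: (GL _ GT) => ->; rewrite ?rmorphN rmorph1 ?sqrrN expr1n.
have uA : A \is a GRing.unit.
  rewrite -[X in is_true X]/(A \in unitmx) unitmxE.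
  by rewrite -(unitrX_pos _ (ltn0Sn 1)) dA unitr1.
have [M M0 AM] := automorphism_torsion hf d3 sf uA dA
  (fun z => subgroup_zero_locus Cf GT).
exists M => //; have : map_mx intr (T ^+ M) = map_mx intr 1%:M :> 'M[R[i]]_n.
  by rewrite map_mx1 rmorphXn.
move=> /matrixP TM; apply/matrixP => i j; have := TM i j.
by rewrite mxE [RHS]mxE => /intr_inj.
Qed.

End GroupAction.

Theorem theorem1p4 (R : realType) (n d : nat) (C : set 'cV[R]_n)
  (C_cone : convex_cone C) (C_closed : closed C) (C_full : full_dimensional C)
  (C_smooth : smooth_algebraic_boundary d C)
  (n_ge4 : (4 <= n)%N) (d_ge3 : (3 <= d)%N) (nd_neq : (n, d) <> (4, 4)%N) :
  ~ RG_finitely_generated C.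
Proof.
case: n C C_cone C_closed C_full C_smooth n_ge4 {nd_neq} => //.
move=> n' C CC Ccl Cfull.
move=> [f [hf Cf sf]] n4 [Rt [G [finR RtC [Ggrp _] [GC _] gen]]].
have finG : finite_set G.
  apply: torsion_subgroup_finite => // T GT.
  by apply: (subgroup_torsion Ccl Ggrp GC hf).
(* With [G] finite, the translates of the generators form a finite list whose cone contains every
   lattice point of [C]. *)
have /finite_seqP[s es] : finite_set [set act T r | T in G & r in Rt].
  exact: finite_image2.
have sC v : v \in s -> C v.
  move=> vs; have : [set` s] v by [].
  rewrite -es => -[T GT [r /RtC[Cr _] <-]]; exact: (subgroup_cone GC).
have latC x : lattice_points C x -> cone s x.
  move=> /gen[k [r [T [lam [rT ->]]]]].
  apply: (big_ind (cone s)) => [||i _]; [exact: cone0|exact: coneD|].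
  rewrite -scaler_nat; apply: coneZ => //; apply: cone_mem.
  suff : [set` s] (act (T i) (r i)) by [].
  by rewrite -es; have [Ri Gi] := rT i; exists (T i) => //; exists (r i).
have [L [L0 bL]] := boundary_in_hyperplanes CC Ccl Cfull sC latC.
pose c := map_mx (real_complex R) : 'rV[R]_n'.+1 -> 'rV[R[i]]_n'.+1.
apply: (@hypersurface_not_in_hyperplanes _ _ d f [seq c l | l <- L]) => //.
- by apply: leq_trans d_ge3.
- by apply: leq_trans n4.
- by move=> _ /mapP[l lL ->]; rewrite map_mx_eq0; apply: L0.
move=> z fz; have : zero_locus f z by [].
(* The product of the linear forms vanishes on the boundary, so it vanishes on the Zariski closure
   too. *)
rewrite -Cf => /(_ (\prod_(l <- L) linform (c l))).
rewrite /zero_locus /= /peval rmorph_prod => h.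
have /eqP : \prod_(l <- L) meval (fun i => z i ord0) (linform (c l)) = 0.
  apply: h => _ [x /bL[l lL lx] <-]; rewrite /= /peval rmorph_prod.
  apply/eqP; rewrite prodf_seq_eq0; apply/hasP; exists l => //=.
  rewrite -/(peval _ _) peval_linform -map_mxM mxE.
  by move: lx; rewrite /dot => ->; rewrite rmorph0.
rewrite prodf_seq_eq0 => /hasP[l lL /=].
rewrite -/(peval _ _) peval_linform => /eqP lz.
by exists (c l) => //; apply: map_f.
Qed.
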